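(* Let $\mathcal{S}$ be a terminating string rewrite system, i.e. a finite TRS over a finite signature in which every function symbol has arity $0$ or $1$. Define $$f(n) := \max\{\mathrm{dh}(t^\sharp,\to_{\mathrm{DP}(\mathcal{S})/\mathcal{S}}) \mid |t|\leqslant n\}.$$ Then there exists $d\in\mathbb{N}$ such that for all $n$, $$\mathrm{dc}_{\mathcal{S}}(n) \leqslant n\cdot 2^{d\cdot(f(n)+1)}.$$
   Context: $|t|$ is the number of occurrences of function symbols and variables in $t$. $\mathrm{dh}(s,\to) = \max\{n\mid \exists t,\ s\to^n t\}$ and $\mathrm{dc}_{\mathcal{S}}(n)=\max\{\mathrm{dh}(t,\to_{\mathcal{S}})\mid |t|\leqslant n\}$. Defined symbols are roots of left-hand sides. For each $f$ let $f^\sharp$ be a fresh symbol of the same arity; $t^\sharp=t$ for a variable $t$, and $t^\sharp = f^\sharp(t_1,\dots,t_n)$ for $t=f(t_1,\dots,t_n)$. $$\mathrm{DP}(\mathcal{S}) = \{l^\sharp\to u^\sharp \mid l\to r\in\mathcal{S},\ u \text{ a subterm of } r \text{ with defined root},\ u \text{ not a proper subterm of } l\}.$$ $\to_{\mathcal{P}/\mathcal{S}} = \to_{\mathcal{S}}^*\cdot\to_{\mathcal{P}}\cdot\to_{\mathcal{S}}^*$. *)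

(* Defs.v *)
From Stdlib Require Import Relation_Operators.
From HB Require Import structures.
From mathcomp Require Import all_boot.

Set Implicit Arguments.
Unset Strict Implicit.
Unset Printing Implicit Defensive.

(* A finite signature all of whose symbols have arity 0 ([csym]) or 1 ([usym]). *)
Record signature := Signature { csym : finType; usym : finType }.

Definition symbol (F : signature) : Type := (csym F + usym F)%type.

(* First-order terms over [F] and the countably infinite set [nat] of variables. *)
Inductive term (F : signature) : Type :=
| Var of nat
| Cst of csym F
| App of usym F & term F.

Arguments Var {F} x.
Arguments Cst {F} c.
Arguments App {F} f t.

Lemma term_comparable (F : signature) : comparable (term F).
Proof.
elim=> [x|c|f s IHs] [y|d|g t]; rewrite /decidable; try by right.
- by case: (x =P y) => [->|ne]; [left | right; case].
- by case: (c =P d) => [->|ne]; [left | right; case].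
- case: (f =P g) => [->|ne]; last by right; case.
  by case: (IHs t) => [->|ne]; [left | right; case].
Qed.

HB.instance Definition _ (F : signature) :=
  hasDecEq.Build (term F) (compareP (@term_comparable F)).

Section Terms.

Variable F : signature.
Implicit Types (s t u : term F) (sigma : nat -> term F).

Fixpoint tsize t : nat :=
  match t with
  | Var _ => 1
  | Cst _ => 1
  | App _ t' => (tsize t').+1
  end.

Fixpoint vars t : seq nat :=
  match t with
  | Var x => [:: x]
  | Cst _ => [::]
  | App _ t' => vars t'
  end.

Definition root t : option (symbol F) :=
  match t with
  | Var _ => None
  | Cst c => Some (inl c)
  | App f _ => Some (inr f)
  end.

Fixpoint subterms t : seq (term F) :=
  t :: match t with
       | App _ t' => subterms t'
       | _ => [::]
       end.

Definition proper_subterms t : seq (term F) :=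
  if t is App _ t' then subterms t' else [::].

Fixpoint subst sigma t : term F :=
  match t with
  | Var x => sigma x
  | Cst c => Cst c
  | App f t' => App f (subst sigma t')
  end.

(* The pair (l, r) stands for the rule l -> r. *)
Definition trs := seq (term F * term F).

Definition wf_trs (S : trs) : Prop :=
  forall l r, (l, r) \in S -> root l <> None /\ {subset vars r <= vars l}.

Inductive rew (S : trs) : term F -> term F -> Prop :=
| rew_root l r sigma of (l, r) \in S : rew S (subst sigma l) (subst sigma r)
| rew_app f s t of rew S s t : rew S (App f s) (App f t).

Definition rew_mod (P S : trs) s t : Prop :=
  exists s' t', [/\ clos_refl_trans _ (rew S) s s', rew P s' t'
                  & clos_refl_trans _ (rew S) t' t].

Definition defined (S : trs) (f : symbol F) : bool :=
  has (fun rule => root rule.1 == Some f) S.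

Definition has_defined_root (S : trs) t : bool :=
  if root t is Some f then defined S f else false.

End Terms.

Definition terminating (T : Type) (R : T -> T -> Prop) : Prop :=
  ~ exists a : nat -> T, forall i, R (a i) (a i.+1).

Fixpoint nsteps (T : Type) (R : T -> T -> Prop) (n : nat) (s t : T) : Prop :=
  if n is m.+1 then exists2 u, R s u & nsteps R m u t else s = t.

(* m = max A, with the convention max (empty set) = 0; the latter is only
   relevant for the maximum over all terms of size at most 0. *)
Definition is_max (A : nat -> Prop) (m : nat) : Prop :=
  (A m \/ (m = 0 /\ forall k, ~ A k)) /\ (forall k, A k -> k <= m).

Definition is_dh (T : Type) (R : T -> T -> Prop) (s : T) (h : nat) : Prop :=
  is_max (fun n => exists t, nsteps R n s t) h.

(* m = max {dh(s, R) | A s}.  The first conjunct requires dh(s, R) to exist for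
   every s in A, so that no s is silently dropped from the maximum. *)
Definition is_max_dh (T : Type) (R : T -> T -> Prop) (A : T -> Prop) (m : nat) :
    Prop :=
  (forall s, A s -> exists h, is_dh R s h) /\
  is_max (fun h => exists2 s, A s & is_dh R s h) m.

Definition is_dc (F : signature) (S : trs F) (n m : nat) : Prop :=
  is_max_dh (rew S) (fun t => tsize t <= n) m.

(* The signature extended with fresh sharp symbols: [inl] injects the original
   symbols, [inr f] is the sharp version of [f]. *)
Definition sharp_sig (F : signature) : signature :=
  {| csym := (csym F + csym F)%type; usym := (usym F + usym F)%type |}.

Fixpoint lift_term (F : signature) (t : term F) : term (sharp_sig F) :=
  match t with
  | Var x => Var x
  | Cst c => @Cst (sharp_sig F) (inl c)
  | App f t' => @App (sharp_sig F) (inl f) (lift_term t')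
  end.

Definition lift_trs (F : signature) (S : trs F) : trs (sharp_sig F) :=
  [seq (lift_term rule.1, lift_term rule.2) | rule <- S].

Definition sharp (F : signature) (t : term F) : term (sharp_sig F) :=
  match t with
  | Var x => Var x
  | Cst c => @Cst (sharp_sig F) (inr c)
  | App f t' => @App (sharp_sig F) (inr f) (lift_term t')
  end.

Definition DP (F : signature) (S : trs F) : trs (sharp_sig F) :=
  [seq (sharp rule.1, sharp u) | rule <- S,
     u <- [seq u <- subterms rule.2
          | has_defined_root S u & u \notin proper_subterms rule.1]].

(* m = max {dh(t^sharp, ->_{DP(S)/S}) | |t| <= n}, with t ranging over the terms
   over the original signature. *)
Definition is_max_dp_dh (F : signature) (S : trs F) (n m : nat) : Prop :=
  is_max_dh (rew_mod (DP S) (lift_trs S))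
    (fun s => exists2 t : term F, tsize t <= n & s = sharp t) m.

(* Maxima are unique, so the predicates above determine functions. *)
Lemma is_max_unique (A : nat -> Prop) (m m' : nat) :
  is_max A m -> is_max A m' -> m = m'.
Proof.
move=> [[Am|[-> A0]] le_m] [[Am'|[-> A0']] le_m'] //.
- by apply/eqP; rewrite eqn_leq le_m' ?le_m.
- by case: (A0' m).
- by case: (A0 m').
Qed.

(* Main.v *)
(** Give a subterm v with defined root the weight 2^(d * dh(v^sharp)), where 2^d
exceeds the size of every right-hand side, and let W t be the sum of the weights
of all subterms of t. A rewrite step does not increase the weight of a subterm
above the redex. At the redex, l sigma is replaced by r sigma; since terms are
strings, the subterms of r that are proper subterms of l form a suffix of r, so
their instances already occur in l sigma, and each of the fewer than 2^d others
has undefined root or smaller dh than l sigma, by a dependency pair. Hence W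
decreases at every step, and dh(t) <= W t <= |t| * 2^(d * f(|t|)).

All maxima exist: S is finitely branching and one variable is as good as
infinitely many, so Koenig's lemma bounds dc_S(n); and a DP(S)/S-derivation
from t^sharp is simulated by an S-derivation from t. *)
From Stdlib Require Import Relation_Operators Operators_Properties
  Classical ClassicalEpsilon.
From mathcomp Require Import all_boot.
Require Import Defs.

Set Implicit Arguments.
Unset Strict Implicit.
Unset Printing Implicit Defensive.

(** * Maxima, derivation lengths and Koenig's lemma for abstract relations *)

Lemma bounded_is_max (A : nat -> Prop) (N : nat) :
  (forall k, A k -> k <= N) -> exists m, is_max A m.
Proof.
elim: N => [|N IHN] AN.
  exists 0; split=> //.
  (* If 0 is not in [A] either, then [A] is empty and the maximum is 0 by convention. *)
  case: (classic (A 0)) => [A0|nA0]; [by left | right; split=> // k Ak].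
  by apply: nA0; have := AN k Ak; rewrite leqn0 => /eqP <-.
case: (classic (A N.+1)) => [AN1|nAN1]; first by exists N.+1; split=> //; left.
apply: IHN => k Ak; move: (AN k Ak); rewrite leq_eqVlt => /orP[/eqP kN|//].
by case: nAN1; rewrite -kN.
Qed.

Section AbstractReduction.

Variables (T : Type) (R : T -> T -> Prop).

Definition steps_bounded (N : nat) (s : T) : Prop :=
  forall n t, nsteps R n s t -> n <= N.

Lemma steps_bounded_is_dh N s : steps_bounded N s -> exists h, is_dh R s h.
Proof. by move=> sN; apply: (@bounded_is_max _ N) => n [t /sN]. Qed.

Lemma is_dh_max h s : is_dh R s h -> steps_bounded h s.
Proof. by case=> _ hP n t snt; apply: hP; exists t. Qed.

Lemma is_dh_attained h s : is_dh R s h -> exists t, nsteps R h s t.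
Proof. by case=> -[//|[-> _]] _; exists s. Qed.

Lemma steps_bounded_is_max_dh N (A : T -> Prop) :
  (forall s, A s -> steps_bounded N s) -> exists m, is_max_dh R A m.
Proof.
move=> AN; suff [m mP] : exists m, is_max (fun h => exists2 s, A s & is_dh R s h) m.
  by exists m; split=> // s /AN; apply: steps_bounded_is_dh.
apply: (@bounded_is_max _ N) => h [s /AN sN /is_dh_attained[t]].
exact: sN.
Qed.

Lemma is_max_dh_bounded (A : T -> Prop) m s :
  is_max_dh R A m -> A s -> steps_bounded m s.
Proof.
move=> [dhA [_ mP]] As; have [h hP] := dhA s As.
have hm : h <= m by apply: mP; exists s.
by move=> n t /(is_dh_max hP) /leq_trans; apply.
Qed.

Lemma is_max_dh_le (A : T -> Prop) m N :
  is_max_dh R A m -> (forall s, A s -> steps_bounded N s) -> m <= N.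
Proof.
move=> [_ [[[s As /is_dh_attained[t st]]|[-> _]] _]] AN //.
exact: (AN s As _ t).
Qed.

Lemma steps_bounded_decreasing (W : T -> nat) s :
  (forall s t, R s t -> W t < W s) -> steps_bounded (W s) s.
Proof.
move=> decW n t; elim: n s => // n IHn s [u /decW us /IHn nu].
exact: leq_ltn_trans us.
Qed.

Lemma nsteps_trans m n s t u :
  nsteps R m s t -> nsteps R n t u -> nsteps R (m + n) s u.
Proof.
elim: m s => [s -> //|m IHm] s /= [v sv vt] tu.
by exists v => //; apply: IHm vt tu.
Qed.

(** By contraposition: if all of the finitely many successors of an element have bounded
    derivations, so does the element. Hence an unbounded element has an unbounded successor, and
    choice iterates this into an infinite derivation. *)
Lemma koenig :
  (forall s, exists (L : seq T), forall t, R s t -> List.In t L) ->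
  terminating R -> forall s, exists N, steps_bounded N s.
Proof.
move=> fin_br termR s0; apply: NNPP => s0_unb; apply: termR.
have next s : ~ (exists N, steps_bounded N s) ->
    exists2 t, R s t & ~ exists N, steps_bounded N t.
  move=> s_unb; apply: NNPP => no_next; apply: s_unb.
  have [L LP] := fin_br s.
  have [N NP] : exists N, forall t, List.In t L -> R s t -> steps_bounded N t.
    elim: L {LP} => [|a L [N NP]]; first by exists 0.
    (* The list may contain terms that are not successors of [s]; no bound is known for them, so
       they are skipped. *)
    case: (classic (R s a)) => [Rsa|nRsa]; last first.
      by exists N => t [<- //|]; apply: NP.
    have [M MP] : exists M, steps_bounded M a.
      by apply: NNPP => a_unb; apply: no_next; exists a.
    exists (maxn M N) => t [<- _|tL Rst] n u.
      by move/MP=> nM; rewrite leq_max nM.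
    by move/(NP t tL Rst)=> nN; rewrite leq_max nN orbT.
  exists N.+1 => -[|n] t //= [u Rsu]; exact: NP (LP u Rsu) Rsu n t.
pose U := {s | ~ exists N, steps_bounded N s}.
have step (s : U) : {t : U | R (sval s) (sval t)}.
  apply: constructive_indefinite_description.
  by case: s => s s_unb; have [t Rst t_unb] := next s s_unb; exists (exist _ t t_unb).
exists (fun i => sval (iter i (fun s => sval (step s)) (exist _ s0 s0_unb))).
by move=> i; rewrite iterS; apply: (svalP (step _)).
Qed.

End AbstractReduction.

(** * Subterms, substitutions and finite branching *)

Section Terms.

Variable F : signature.
Implicit Types (s t u l r : term F) (sigma tau : nat -> term F) (S P : trs F).

Lemma rew_inv S s t : rew S s t ->
  (exists l r sigma, [/\ (l, r) \in S, s = subst sigma l & t = subst sigma r])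
  \/ (exists f s' t', [/\ s = App f s', t = App f t' & rew S s' t']).
Proof.
case=> [l r sigma lr|f s' t' st]; first by left; exists l, r, sigma.
by right; exists f, s', t'.
Qed.

Lemma eq_subst sigma tau t :
  {in vars t, sigma =1 tau} -> subst sigma t = subst tau t.
Proof.
elim: t => //= [x|f t IHt] eq_st; first by apply: eq_st; rewrite inE.
by rewrite IHt.
Qed.

Lemma subst_inj sigma tau t :
  subst sigma t = subst tau t -> {in vars t, sigma =1 tau}.
Proof.
elim: t => //= [x e y|f t IHt [/IHt //]].
by rewrite inE => /eqP ->.
Qed.

Lemma subst_comp sigma tau t :
  subst sigma (subst tau t) = subst (fun x => subst sigma (tau x)) t.
Proof. by elim: t => //= f t ->. Qed.

Lemma subterms_Var u x : (u \in subterms (Var x)) = (u == Var x).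
Proof. by rewrite inE. Qed.

Lemma subterms_Cst u c : (u \in subterms (Cst c)) = (u == Cst c).
Proof. by rewrite inE. Qed.

Lemma subterms_App u f t :
  (u \in subterms (App f t)) = (u == App f t) || (u \in subterms t).
Proof. by rewrite inE. Qed.

Definition in_subterms := (subterms_Var, subterms_Cst, subterms_App).

Lemma subterms_refl t : t \in subterms t.
Proof. by case: t => *; rewrite in_subterms eqxx. Qed.

Lemma subterms_trans u v t :
  u \in subterms v -> v \in subterms t -> u \in subterms t.
Proof.
move=> uv; elim: t => [x|c|f t IHt]; rewrite [v \in _]in_subterms; try by move/eqP <-.
by case/orP=> [/eqP <- //|/IHt]; rewrite in_subterms => ->; rewrite orbT.
Qed.

Lemma var_subterms x t : x \in vars t -> Var x \in subterms t.
Proof.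
elim: t => //= [y|f t IHt]; first by rewrite !inE => /eqP ->.
by move/IHt; rewrite in_subterms => ->; rewrite orbT.
Qed.

Lemma var_proper_subterms x t :
  root t <> None -> x \in vars t -> Var x \in proper_subterms t.
Proof. by case: t => //= f t _; apply: var_subterms. Qed.

Lemma subterms_subst sigma u t :
  u \in subterms t -> subst sigma u \in subterms (subst sigma t).
Proof.
elim: t => [x|c|f t IHt]; rewrite in_subterms.
1-2: by move/eqP->; apply: subterms_refl.
case/orP=> [/eqP ->|/IHt]; first exact: subterms_refl.
by rewrite subterms_App => ->; rewrite orbT.
Qed.

Lemma rew_subst S sigma s t :
  rew S s t -> rew S (subst sigma s) (subst sigma t).
Proof.
elim=> [l r tau lr|f s' t' _ IH]; last exact: rew_app.
by rewrite !subst_comp; apply: rew_root.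
Qed.

Lemma nsteps_subst S sigma n s t :
  nsteps (rew S) n s t -> nsteps (rew S) n (subst sigma s) (subst sigma t).
Proof.
elim: n s => /= [s -> //|n IHn s [u su /IHn ut]].
by exists (subst sigma u) => //; apply: rew_subst.
Qed.

(** A derivation from a subterm can be replayed inside its context, with the same length. *)
Lemma nsteps_subterm S n s t u :
  s \in subterms t -> nsteps (rew S) n s u -> exists v, nsteps (rew S) n t v.
Proof.
move=> + su; elim: t => [x|c|f t IHt]; rewrite in_subterms.
1-2: by move/eqP <-; exists u.
case/orP=> [/eqP <-|/IHt[v tv]]; first by exists u.
exists (App f v); elim: n t {IHt su} tv => /= [t -> //|n IHn t [w tw /IHn wv]].
by exists (App f w) => //; apply: rew_app.
Qed.

(** A rule yields at most one root reduct of [s]: matching determines the substitution on the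
    variables of [l], which include those of [r]. *)
Lemma root_rew_finitely_branching S s :
  wf_trs S -> exists L : seq (term F), forall l r sigma, (l, r) \in S ->
    s = subst sigma l -> List.In (subst sigma r) L.
Proof.
move=> S_wf; have: {subset S <= S} by [].
(* The induction is over a list [P] of rules contained in [S], so that well-formedness of [S] stays
   available. *)
elim: {1 3}S => [|[l r] P IHP] PS; first by exists [::].
have [|L LP] := IHP; first by move=> x xP; apply: PS; rewrite inE xP orbT.
have lr : (l, r) \in S by apply: PS; rewrite inE eqxx.
case: (classic (exists sigma, s = subst sigma l)) => [[sigma se]|no].
  exists (subst sigma r :: L) => l' r' tau.
  rewrite inE => /orP[/eqP[-> ->]|/LP lP /lP]; last by right.
  rewrite se => /subst_inj eq_st; left; apply: eq_subst => x.
  by case: (S_wf _ _ lr) => _ sub /sub; apply: eq_st.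
exists L => l' r' tau; rewrite inE => /orP[/eqP[-> ->] se|]; last exact: LP.
by case: no; exists tau.
Qed.

Lemma rew_finitely_branching S : wf_trs S ->
  forall s, exists L : seq (term F), forall t, rew S s t -> List.In t L.
Proof.
move=> S_wf; elim=> [x|c|f s [L1 L1P]].
- have [L LP] := root_rew_finitely_branching (Var x) S_wf; exists L => t.
  by move=> /rew_inv[[l [r [sigma [lr se ->]]]]|[f [s' [t' [//]]]]]; apply: LP lr se.
- have [L LP] := root_rew_finitely_branching (Cst c) S_wf; exists L => t.
  by move=> /rew_inv[[l [r [sigma [lr se ->]]]]|[f [s' [t' [//]]]]]; apply: LP lr se.
have [L LP] := root_rew_finitely_branching (App f s) S_wf.
exists (L ++ [seq App f t | t <- L1]) => t; move/rew_inv.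
case=> [[l [r [sigma [lr se ->]]]]|[g [s' [t' [[<- <-] -> st]]]]].
  by apply: List.in_or_app; left; apply: LP lr se.
by apply: List.in_or_app; right; apply: List.in_map; apply: L1P.
Qed.

(* Every variable is renamed to [Var 0], since there are infinitely many terms
   of a given size. *)
Lemma steps_bounded_tsize S n : wf_trs S -> terminating (rew S) ->
  exists N, forall t, tsize t <= n -> steps_bounded (rew S) N t.
Proof.
move=> S_wf S_term; pose var0 (_ : nat) : term F := Var 0.
have [L LP] : exists L : seq (term F),
    forall t, tsize t <= n -> subst var0 t \in L.
  elim: n => [|n [L LP]]; first by exists [::] => -[].
  exists (Var 0 :: [seq Cst c | c <- enum (csym F)]
            ++ [seq App f t | f <- enum (usym F), t <- L]) => t.
  case: t => [x|c|f t] /= tn; rewrite inE ?eqxx //.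
    by rewrite mem_cat map_f ?mem_enum ?orbT.
  rewrite mem_cat; apply/orP; right; apply/orP; right.
  by apply/allpairsP; exists (f, subst var0 t); rewrite /= mem_enum LP.
have [N NP] : exists N, {in L, forall t, steps_bounded (rew S) N t}.
  elim: L {LP} => [|a L [N NP]]; first by exists 0.
  have [M MP] := koenig (rew_finitely_branching S_wf) S_term a.
  exists (maxn M N) => t; rewrite inE => /orP[/eqP ->|/NP tN] m u.
    by move/MP=> mM; rewrite leq_max mM.
  by move/tN=> mN; rewrite leq_max mN orbT.
exists N => t /LP /NP tN m u /(nsteps_subst var0); exact: tN.
Qed.

Lemma lhs_defined_root S l r sigma :
  wf_trs S -> (l, r) \in S -> has_defined_root S (subst sigma l).
Proof.
move=> S_wf lr; have [nvar _] := S_wf _ _ lr.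
by case: l lr nvar => // [c|f l] lr _; apply/hasP; esplit; (exact: lr || exact: eqxx).
Qed.

End Terms.

(** * Transfer of rewrite steps between the original and the sharped signature *)

Section DependencyPairs.

Variable F : signature.
Implicit Types (s t u v l r : term F) (S : trs F).
Implicit Types (x y z : term (sharp_sig F)).

(** A common left inverse of [lift_term] and [sharp]. Being total, it also turns any substitution
    over the sharped signature into one over [F]. *)
Fixpoint unsharp x : term F :=
  match x with
  | Var i => Var i
  | Cst (inl c) | Cst (inr c) => Cst c
  | App (inl f) x' | App (inr f) x' => App f (unsharp x')
  end.

Lemma lift_termK t : unsharp (lift_term t) = t.
Proof. by elim: t => //= f t ->. Qed.

Lemma sharpK t : unsharp (sharp t) = t.
Proof. by case: t => //= f t; rewrite lift_termK. Qed.

Lemma unsharp_subst sigma x :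
  unsharp (subst sigma x) = subst (unsharp \o sigma) (unsharp x).
Proof. by elim: x => //= [[]|[] f x ->]. Qed.

Lemma vars_lift_term t : vars (lift_term t) = vars t.
Proof. by elim: t. Qed.

Lemma vars_sharp t : vars (sharp t) = vars t.
Proof. by case: t => //= f t; apply: vars_lift_term. Qed.

Lemma subst_lift_term (sigma : nat -> term F) t :
  subst (@lift_term F \o sigma) (lift_term t) = lift_term (subst sigma t).
Proof. by elim: t => //= f t ->. Qed.

Lemma subst_sharp (sigma : nat -> term F) t :
  root t <> None -> subst (@lift_term F \o sigma) (sharp t) = sharp (subst sigma t).
Proof. by case: t => //= f t _; rewrite subst_lift_term. Qed.

(** A substitution may in general introduce sharp symbols. Here its value at the variable of [t] is
    a subterm of a lifted term, hence itself lifted and fixed by [lift_term] after [unsharp]. *)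
Lemma subst_lift_term_inv sigma t s : subst sigma (lift_term t) = lift_term s ->
  {in vars t, sigma =1 @lift_term F \o (unsharp \o sigma)}.
Proof.
elim: t s => //= [i|f t IHt] [j|d|g s] //=.
- by move=> e k; rewrite inE => /eqP ->; rewrite /= e.
- by move=> e k; rewrite inE => /eqP ->; rewrite /= e.
- by move=> e k; rewrite inE => /eqP ->; rewrite /= e /= lift_termK.
by case=> _; apply: IHt.
Qed.

Lemma subst_sharp_inv sigma t s : root t <> None ->
  subst sigma (sharp t) = sharp s ->
  {in vars t, sigma =1 @lift_term F \o (unsharp \o sigma)}.
Proof.
by case: t s => // f t [//|//|g s] _ [_]; apply: subst_lift_term_inv.
Qed.

Lemma lift_trsP S x y : (x, y) \in lift_trs S ->
  exists l r, [/\ (l, r) \in S, x = lift_term l & y = lift_term r].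
Proof. by case/mapP=> -[l r] lr [-> ->]; exists l, r. Qed.

Lemma DP_P S x y : (x, y) \in DP S <->
  exists l r u, [/\ (l, r) \in S, u \in subterms r, has_defined_root S u,
    u \notin proper_subterms l & x = sharp l /\ y = sharp u].
Proof.
split=> [/allpairsPdep[[l r] [u [lr]]]|].
  rewrite mem_filter => /andP[/andP[udef ul] ur] [-> ->].
  by exists l, r, u.
move=> [l [r [u [lr ur udef ul [-> ->]]]]].
apply/allpairsPdep; exists (l, r), u; split=> //.
by rewrite mem_filter udef ul ur.
Qed.

Lemma rew_lift S s t : rew S s t -> rew (lift_trs S) (lift_term s) (lift_term t).
Proof.
elim=> [l r sigma lr|f s' t' _]; last exact: (@rew_app (sharp_sig F)).
rewrite -!subst_lift_term; apply: rew_root.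
by apply/mapP; exists (l, r).
Qed.

Lemma lift_match S l r sigma s : wf_trs S -> (l, r) \in S ->
  subst sigma (lift_term l) = lift_term s ->
  exists2 tau, s = subst tau l & subst sigma (lift_term r) = lift_term (subst tau r).
Proof.
move=> S_wf lr e; exists (unsharp \o sigma).
  by rewrite -[LHS]lift_termK -e unsharp_subst lift_termK.
rewrite -subst_lift_term; apply: eq_subst => k; rewrite vars_lift_term => kr.
by apply: subst_lift_term_inv e _ _; case: (S_wf _ _ lr) => _; apply.
Qed.

Lemma rew_lift_inv S s y : wf_trs S -> rew (lift_trs S) (lift_term s) y ->
  exists2 t, y = lift_term t & rew S s t.
Proof.
move=> S_wf; elim: s y => [i|c|f s IHs] y /rew_inv[];
  try by move=> [? [? [? []]]].
1-3: move=> [x [z [sigma [/lift_trsP[l [r [lr -> ->]]] /esym e ->]]]].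
1-3: have [tau -> ->] := lift_match S_wf lr e.
1-3: by exists (subst tau r) => //; apply: rew_root.
case=> g [x [z [[<- <-] -> /IHs[t -> st]]]].
by exists (App f t) => //; apply: rew_app.
Qed.

Lemma rew_lift_sharp S f s t : rew S s t ->
  rew (lift_trs S) (sharp (App f s)) (sharp (App f t)).
Proof. by move/rew_lift; apply: (@rew_app (sharp_sig F)). Qed.

(** Left-hand sides of lifted rules have unsharped roots, so the step takes place below the root of
    [sharp s]. *)
Lemma rew_lift_sharp_inv S s y : wf_trs S -> rew (lift_trs S) (sharp s) y ->
  exists2 t, y = sharp t & rew S s t.
Proof.
move=> S_wf /rew_inv[].
  move=> [x [z [sigma [/lift_trsP[l [r [lr -> ->]]] e _]]]].
  have [nvar _] := S_wf _ _ lr.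
  by case: l nvar e {lr} => // [c|f l] _; case: s.
case: s => [i|c|f s] [g [x [z [//]]]].
case=> <- <- -> /(rew_lift_inv S_wf)[t -> st].
by exists (App f t) => //; apply: rew_app.
Qed.

Lemma rew_star_lift_sharp_inv S s y : wf_trs S ->
  clos_refl_trans _ (rew (lift_trs S)) (sharp s) y ->
  exists2 t, y = sharp t & exists n, nsteps (rew S) n s t.
Proof.
move=> S_wf sy; have {sy} := clos_rt_rt1n _ _ _ _ sy.
move: {2 3}(sharp s) (erefl (sharp s)) => x xs xy; elim: xy s xs => {x y}.
  by move=> x s <-; exists s => //; exists 0.
move=> x y z xy _ IH s xs; move: xy; rewrite -xs => /(rew_lift_sharp_inv S_wf)[t yt st].
have [u zu [n tu]] := IH t (esym yt).
by exists u => //; exists n.+1; exists t.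
Qed.

Lemma rew_DP S l r u sigma : wf_trs S -> (l, r) \in S ->
  u \in subterms r -> has_defined_root S u -> u \notin proper_subterms l ->
  rew (DP S) (sharp (subst sigma l)) (sharp (subst sigma u)).
Proof.
move=> S_wf lr ur udef ul; rewrite -!subst_sharp.
- by apply: rew_root; apply/DP_P; exists l, r, u.
- by move: udef; rewrite /has_defined_root; case: (root u).
by case: (S_wf _ _ lr).
Qed.

Lemma rew_DP_lift_inv S s y : wf_trs S -> ~ rew (DP S) (lift_term s) y.
Proof.
move=> S_wf; elim: s y => [i|c|f s IHs] y /rew_inv[].
1,3,5: move=> [x [z [sigma [/DP_P[l [r [u [lr _ _ _ [-> _]]]]] e _]]]].
1-3: by have [nvar _] := S_wf _ _ lr; case: l nvar e {lr}.
1-2: by move=> [? [? [? []]]].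
by case=> g [x [z [[_ <-] _ /IHs]]].
Qed.

(** Specific to strings: every subterm is a suffix and contains the only leaf. *)
Lemma subterms_vars u r : u \in subterms r -> vars u = vars r.
Proof.
elim: r => [i|c|f r IHr]; rewrite in_subterms; try by move/eqP->.
by case/orP=> [/eqP -> //|/IHr].
Qed.

(** The pair from [sharp l] to [sharp u] acts like the rule from [l] to [r] followed by passing to
    the subterm [u] of [r]. *)
Lemma rew_DP_sharp_inv S s y : wf_trs S -> rew (DP S) (sharp s) y ->
  exists t v, [/\ y = sharp v, rew S s t & v \in subterms t].
Proof.
move=> S_wf /rew_inv[]; last first.
  case: s => [i|c|f s] [g [x [z [//]]]].
  by case=> _ <- _ /(rew_DP_lift_inv S_wf).
move=> [x [z [sigma [/DP_P[l [r [u [lr ur udef _ [-> ->]]]]] /esym e ->]]]].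
have [lnvar sub] := S_wf _ _ lr; pose tau := unsharp \o sigma.
exists (subst tau r), (subst tau u); split; last exact: subterms_subst.
  rewrite -subst_sharp; last by move: udef; rewrite /has_defined_root; case: (root u).
  apply: eq_subst => k; rewrite vars_sharp (subterms_vars ur) => /sub.
  exact: subst_sharp_inv lnvar e _.
rewrite -[s]sharpK -e unsharp_subst sharpK; exact: rew_root.
Qed.

(** Each dependency pair step costs one [S]-step, and whatever follows in a subterm is replayed in
    the whole term. This makes the heights of sharped terms finite. *)
Lemma nsteps_rew_mod_inv S n s y : wf_trs S ->
  nsteps (rew_mod (DP S) (lift_trs S)) n (sharp s) y ->
  exists m t, n <= m /\ nsteps (rew S) m s t.
Proof.
move=> S_wf; elim: n s => [|n IHn] s /=; first by exists 0, s.
move=> [x [x1 [x2 [/(rew_star_lift_sharp_inv S_wf)[s1 -> [m1 ss1]]]]]].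
move/(rew_DP_sharp_inv S_wf)=> [t [v [-> s1t vt]]].
move/(rew_star_lift_sharp_inv S_wf)=> [s2 -> [m2 vs2]] /IHn[m3 [w [nm3 s2w]]].
have vw := nsteps_trans vs2 s2w.
have [w' tw'] := nsteps_subterm vt vw.
(* The successor accounts for the [S]-step from [s1] to [t] that simulates the dependency pair. *)
exists (m1 + (m2 + m3).+1), w'; split.
  by rewrite addnS ltnS (leq_trans nm3) // addnA leq_addl.
by apply: nsteps_trans ss1 _; exists t.
Qed.

(** * The weight of a term and its decrease under rewriting *)

Section Weight.

Variable S : trs F.
Hypotheses (S_wf : wf_trs S) (S_term : terminating (rew S)).

Local Notation dpS := (rew_mod (DP S) (lift_trs S)).

Lemma steps_bounded_sharp N t :
  steps_bounded (rew S) N t -> steps_bounded dpS N (sharp t).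
Proof.
by move=> tN n y /(nsteps_rew_mod_inv S_wf)[m [u [nm /tN]]]; apply: leq_trans.
Qed.

Lemma is_dh_sharp_exists t : exists h, is_dh dpS (sharp t) h.
Proof.
have [N NP] := koenig (rew_finitely_branching S_wf) S_term t.
exact: steps_bounded_is_dh (steps_bounded_sharp NP).
Qed.

Definition dp_height t : nat :=
  sval (constructive_indefinite_description _ (is_dh_sharp_exists t)).

Lemma dp_heightP t : is_dh dpS (sharp t) (dp_height t).
Proof. exact: svalP (constructive_indefinite_description _ _). Qed.

(** An [S]-step below the root can be prepended to the first relative step without changing the
    number of dependency pairs used. This controls the weights above the redex. *)
Lemma dp_height_rew f s t :
  rew S s t -> dp_height (App f t) <= dp_height (App f s).
Proof.
move/(rew_lift_sharp f)=> st.
have [y] := is_dh_attained (dp_heightP (App f t)).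
case: (dp_height _) => // n [x [x1 [x2 [tx1 x12 x2x]]] xy].
apply: (is_dh_max (dp_heightP _)); exists x; last exact: xy.
by exists x1, x2; split=> //; apply: rt_trans tx1; apply: rt_step.
Qed.

Lemma dp_height_DP l r u sigma : (l, r) \in S ->
  u \in subterms r -> has_defined_root S u -> u \notin proper_subterms l ->
  dp_height (subst sigma u) < dp_height (subst sigma l).
Proof.
move=> lr ur udef ul.
have [y uy] := is_dh_attained (dp_heightP (subst sigma u)).
apply: (is_dh_max (dp_heightP _)); exists (sharp (subst sigma u)); last exact: uy.
exists (sharp (subst sigma l)), (sharp (subst sigma u)).
by split; [apply: rt_refl | apply: rew_DP lr ur udef ul | apply: rt_refl].
Qed.

Variable d : nat.
Hypothesis rhs_size : forall l r, (l, r) \in S -> tsize r < 2 ^ d.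

Definition root_weight t : nat :=
  if has_defined_root S t then 2 ^ (d * dp_height t) else 0.

Fixpoint weight t : nat :=
  root_weight t + (if t is App _ t' then weight t' else 0).

(** The share of the proper subterms in [weight]. *)
Definition arg_weight t : nat := if t is App _ t' then weight t' else 0.

Lemma weightE t : weight t = root_weight t + arg_weight t.
Proof. by case: t. Qed.

Lemma weight_subterms u t : u \in subterms t -> weight u <= weight t.
Proof.
elim: t => [i|c|f t IHt]; rewrite in_subterms; try by move/eqP->.
case/orP=> [/eqP -> //|/IHt /leq_trans]; apply; exact: leq_addl.
Qed.

Lemma weight_proper_subterms sigma u t :
  u \in proper_subterms t -> weight (subst sigma u) <= arg_weight (subst sigma t).
Proof.
by case: t => // f t /(subterms_subst sigma) /weight_subterms.
Qed.

(** [B] bounds the root weight of each new subterm of the right-hand side; old subterms are paid for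
    by [arg_weight]. The root weight of the redex covers [2 ^ d] copies of [B]. *)
Lemma weight_rhs l r sigma : (l, r) \in S ->
  exists2 B, 2 ^ d * B <= 2 ^ (d * dp_height (subst sigma l)) &
    weight (subst sigma r) <= tsize r * B + arg_weight (subst sigma l).
Proof.
move=> lr; set h := dp_height _.
(* New subterms with defined root have height at most [h - 1]; for [h = 0] there are none, so 0
   suffices. *)
pose B := if h is h'.+1 then 2 ^ (d * h') else 0.
exists B; first by rewrite {}/B; case: h => [|h']; rewrite ?muln0 // -expnD mulnS.
have new_weight u : u \in subterms r -> u \notin proper_subterms l ->
    has_defined_root S u -> 2 ^ (d * dp_height (subst sigma u)) <= B.
  move=> ur ul udef; have := dp_height_DP sigma lr ur udef ul.
  rewrite -/h {}/B; case: h => // h'; rewrite ltnS => le_h.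
  by rewrite leq_pexp2l // leq_mul2l le_h orbT.
(* Induction along the suffixes of [r]: one that is a proper subterm of [l] is absorbed whole by
   [arg_weight]; any other one adds at most [B] for its root. *)
have suffix_weight u : u \in subterms r ->
    weight (subst sigma u) <= tsize u * B + arg_weight (subst sigma l).
  elim: u => [i|c|f u IHu] ur.
  - have [nvar sub] := S_wf lr.
    (* As [l] is not a variable, a variable of [r] lies properly inside [l], so its instance is
       already counted. *)
    have ul : Var i \in proper_subterms l.
      by apply: var_proper_subterms nvar (sub _ _); rewrite -(subterms_vars ur) inE.
    by apply: leq_trans (weight_proper_subterms sigma ul) (leq_addl _ _).
  - have [ul|ul] := boolP (Cst c \in proper_subterms l).
      by apply: leq_trans (weight_proper_subterms sigma ul) (leq_addl _ _).
    rewrite weightE addn0 mul1n; apply: leq_trans (leq_addr _ _).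
    by rewrite /root_weight; case: ifP => // /(new_weight _ ur ul).
  have [ul|ul] := boolP (App f u \in proper_subterms l).
    by apply: leq_trans (weight_proper_subterms sigma ul) (leq_addl _ _).
  rewrite weightE /= mulSn -addnA leq_add //.
    by rewrite /root_weight; case: ifP => // /(new_weight _ ur ul).
  by apply: IHu; apply: subterms_trans ur; rewrite subterms_App subterms_refl orbT.
exact: suffix_weight (subterms_refl r).
Qed.

Lemma weight_rew s t : rew S s t -> weight t < weight s.
Proof.
elim=> [l r sigma lr|f s' t' st IH]; last first.
  rewrite /= -addnS leq_add //.
  have := dp_height_rew f st; rewrite /root_weight /has_defined_root /=.
  by case: ifP => // _ le_h; rewrite leq_pexp2l // leq_mul2l le_h orbT.
have [B leB le_w] := weight_rhs sigma lr.
apply: leq_ltn_trans le_w _; rewrite (weightE (subst _ l)) ltn_add2r.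
rewrite /root_weight (lhs_defined_root _ S_wf lr).
(* For [B = 0] strictness comes from the positive root weight of the redex, otherwise from
   [tsize r < 2 ^ d]. *)
case: (posnP B) => [->|B_gt0]; first by rewrite muln0 expn_gt0.
by apply: leq_trans leB; rewrite ltn_pmul2r // (rhs_size lr).
Qed.

Lemma weight_le m n t :
  (forall v, tsize v <= n -> dp_height v <= m) -> tsize t <= n ->
  weight t <= tsize t * 2 ^ (d * m).
Proof.
move=> hm; have rw_le v : tsize v <= n -> root_weight v <= 2 ^ (d * m).
  rewrite /root_weight; case: ifP => // _ /hm le_h.
  by rewrite leq_pexp2l // leq_mul2l le_h orbT.
elim: t => [i|c|f t IHt] tn; rewrite weightE ?addn0 ?mul1n ?rw_le //.
by rewrite mulSn leq_add ?rw_le ?IHt // ltnW.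
Qed.

End Weight.

End DependencyPairs.

(** * Existence of the maxima and the exponential bound *)

Theorem theorem6p2 (F : signature) (S : trs F)
    (S_wf : wf_trs S) (S_terminating : terminating (rew S)) :
  exists dc f : nat -> nat,
    [/\ forall n, is_dc S n (dc n),
        forall n, is_max_dp_dh S n (f n)
      & exists d : nat, forall n, dc n <= n * 2 ^ (d * (f n + 1))].
Proof.
have dc_ex n : {m | is_dc S n m}.
  apply: constructive_indefinite_description.
  have [N NP] := steps_bounded_tsize n S_wf S_terminating.
  exact: steps_bounded_is_max_dh NP.
have f_ex n : {m | is_max_dp_dh S n m}.
  apply: constructive_indefinite_description.
  have [N NP] := steps_bounded_tsize n S_wf S_terminating.
  apply: (@steps_bounded_is_max_dh _ _ N) => _ [t /NP tN ->].
  exact: steps_bounded_sharp.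
exists (fun n => sval (dc_ex n)), (fun n => sval (f_ex n)).
split=> [n|n|]; [exact: svalP | exact: svalP |].
(* The sum dominates the size of each right-hand side, and [d < 2 ^ d]. *)
pose d := \sum_(rule <- S) tsize rule.2; exists d => n.
have rhs_size l r : (l, r) \in S -> tsize r < 2 ^ d.
  move=> lr; apply: leq_ltn_trans (ltn_expl d (isT : 1 < 2)).
  by rewrite /d (big_rem _ lr) leq_addr.
case: (f_ex n) => f /= fP; apply: is_max_dh_le (svalP (dc_ex n)) _ => t tn.
have hf v : tsize v <= n -> dp_height S_wf S_terminating v <= f.
  move=> vn; have [y vy] := is_dh_attained (dp_heightP S_wf S_terminating v).
  by apply: (is_max_dh_bounded fP) vy; exists v.
have W_decr := @weight_rew _ _ S_wf S_terminating _ rhs_size.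
move=> k u /(steps_bounded_decreasing W_decr) /leq_trans; apply.
apply: leq_trans (weight_le d hf tn) _.
by rewrite leq_mul // leq_exp2l // leq_mul2l leq_addr orbT.
Qed.
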